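(* Let $f=\frac1n\sum_{i=1}^n f_i$ satisfy the following: (1) each $\nabla f_i$ is $L$-Lipschitz on $\mathbb{R}^d$; (2) $f^*=\inf_{x\in\mathbb{R}^d} f(x)>-\infty$; (3) there is $\sigma>0$ with $\frac1n\sum_{i=1}^n\|\nabla f_i(x)-\nabla f(x)\|^2\le\sigma^2$ for all $x\in\mathbb{R}^d$. Let $\epsilon>0$ and let $c_\beta,c_\epsilon\ge\alpha$ for a certain constant $\alpha>0$. Let $\psi=\frac{2\eta^2L^2m^2}{B}+\frac{2}{\alpha}+2$ and choose $\beta_1>0$, $\alpha$ and $\eta>0$ such that $\beta_1\le\epsilon S$ and $\phi=\frac12-\frac1{2\alpha}-\frac{L\eta}{2}-\frac{\eta^2L^2m^2}{2B}>0$, where $S$ denotes the number of epochs. Then the output $x_\zeta$ of AbaSVRG (run with inputs $x_0,m,B,\eta,c_\beta,c_\epsilon,\beta_1$ and $S$ epochs) satisfies $$\mathbb{E}\|\nabla f(x_\zeta)\|^2\le\frac{\psi\,(f(x_0)-f^* )}{\phi\,\eta K}+\frac{\psi\epsilon}{\phi\alpha}+\frac{4\epsilon}{\alpha},$$ where $K=Sm$ is the total number of iterations.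
   Context: For a finite index set (or list) $\mathcal{S}$ of size $|\mathcal S|$, $\nabla f_{\mathcal{S}}(\cdot)=\frac1{|\mathcal{S}|}\sum_{i\in\mathcal{S}}\nabla f_i(\cdot)$. AbaSVRG. Inputs: $x_0\in\mathbb{R}^d$, positive integers $m$ (epoch length), $B$ (mini-batch size), $S$ (number of epochs), and reals $\eta,c_\beta,c_\epsilon,\beta_1>0$; $\epsilon>0$ is the target accuracy. Set $\tilde x^0=x_0$. For $s=1,\dots,S$: set $x_0^s=\tilde x^{s-1}$; sample $\mathcal{N}_s$ uniformly from $[n]=\{1,\dots,n\}$ without replacement, of size $N_s=\min\{c_\beta\sigma^2\beta_s^{-1},\,c_\epsilon\sigma^2\epsilon^{-1},\,n\}$ (rounded up to an integer; $\beta_s^{-1}=+\infty$ if $\beta_s=0$); set $g^s=\nabla f_{\mathcal{N}_s}(\tilde x^{s-1})$; for $t=1,\dots,m$, draw a fresh independent mini-batch $\mathcal{B}$ of size $B$ uniformly from $[n]$ with replacement and set $v_{t-1}^s=\nabla f_{\mathcal{B}}(x_{t-1}^s)-\nabla f_{\mathcal{B}}(\tilde x^{s-1})+g^s$, $x_t^s=x_{t-1}^s-\eta v_{t-1}^s$; finally set $\beta_{s+1}=\frac1m\sum_{t=1}^m\|v_{t-1}^s\|^2$ and $\tilde x^s=x_m^s$. The output $x_\zeta$ is chosen uniformly at random from $\{x_{t-1}^s\}_{s\in[S],\,t\in[m]}$. *)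

(* Defs.v *)
From HB Require Import structures.
From mathcomp Require Export all_boot all_order all_algebra.
From mathcomp Require Export all_classical all_reals all_analysis.
Export Order.TTheory GRing.Theory Num.Theory.
Export numFieldNormedType.Exports.

Set Implicit Arguments.
Unset Strict Implicit.
Unset Printing Implicit Defensive.

Local Open Scope classical_set_scope.
Local Open Scope ring_scope.

(* The library norm on ['rV[R]_d] is the sup norm, hence this definition. *)
Definition enorm (R : realType) (d : nat) (v : 'rV[R]_d) : R :=
  Num.sqrt (\sum_(j < d) v ord0 j ^+ 2).

Definition grad (R : realType) (d : nat) (h : 'rV[R]_d -> R) (x : 'rV[R]_d) :
    'rV[R]_d :=
  \row_(j < d) 'D_(delta_mx ord0 j) h x.

Definition favg (R : realType) (d n : nat) (f : 'I_n -> 'rV[R]_d -> R)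
    (x : 'rV[R]_d) : R :=
  n%:R^-1 * \sum_(i < n) f i x.

(* [s] is a list, so that mini-batches drawn with replacement count repeated
   indices; a finite set [A] of indices is passed as [enum A]. *)
Definition batch_grad (R : realType) (d n : nat) (f : 'I_n -> 'rV[R]_d -> R)
    (s : seq 'I_n) (x : 'rV[R]_d) : 'rV[R]_d :=
  (size s)%:R^-1 *: \sum_(i <- s) grad (f i) x.

(* All random choices of a run, except the one of the output.  In the
   usual numbering s = 1, ..., S of the epochs, [anchor w s] is the index set
   N_{s+1}, and [batch w s t] is the mini-batch that produces v_t^{s+1}. *)
Record draws (n B : nat) := Draws {
  anchor : nat -> {set 'I_n} ;
  batch : nat -> nat -> B.-tuple 'I_n }.

Section AbaSVRG.
Context (R : realType) (d n m B : nat) (f : 'I_n -> 'rV[R]_d -> R).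
Context (x0 : 'rV[R]_d) (eta cb ce beta1 sigma eps : R).
Implicit Types (xt x : 'rV[R]_d) (A : {set 'I_n}) (b : nat -> B.-tuple 'I_n).

(* [beta = 0] is treated apart because [0^-1 = 0] in the library, while the
   algorithm reads it as [+oo]. *)
Definition anchor_size (beta : R) : nat :=
  let c := Num.min (ce * sigma ^+ 2 * eps^-1) n%:R in
  let N := if beta == 0 then c
           else Num.min (cb * sigma ^+ 2 * beta^-1) c in
  `|Num.ceil N|%N.

Definition svrg_dir xt A (b : B.-tuple 'I_n) x : 'rV[R]_d :=
  batch_grad f b x - batch_grad f b xt + batch_grad f (enum A) xt.

Fixpoint inner xt A b (t : nat) : 'rV[R]_d :=
  if t is t'.+1 then
    let x := inner xt A b t' in x - eta *: svrg_dir xt A (b t') x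
  else xt.

(* [epoch w s] is the pair (\tilde x^s, beta_{s+1}) available after [s] epochs. *)
Fixpoint epoch (w : draws n B) (s : nat) : 'rV[R]_d * R :=
  if s is s'.+1 then
    let xt := (epoch w s').1 in
    let A := anchor w s' in
    let b := batch w s' in
    (inner xt A b m,
     m%:R^-1 * \sum_(t < m) enorm (svrg_dir xt A (b t) (inner xt A b t)) ^+ 2)
  else (x0, beta1).

(* x_t^{s+1} *)
Definition iterate (w : draws n B) (s t : nat) : 'rV[R]_d :=
  inner (epoch w s).1 (anchor w s) (batch w s) t.

Definition agree_epochs (s : nat) (w w' : draws n B) : Prop :=
  forall r, (r < s)%N -> anchor w r = anchor w' r /\
    forall t, (t < m)%N -> batch w r t = batch w' r t.

Definition agree_steps (s t : nat) (w w' : draws n B) : Prop :=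
  [/\ agree_epochs s w w', anchor w s = anchor w' s
    & forall r, (r < t)%N -> batch w s r = batch w' s r].

(* [X] is uniform on [C] conditionally on the event [H]. *)
Definition cond_uniform d' (T : measurableType d') (P : probability T R)
    (H : set T) (U : finType) (X : T -> U) (C : {set U}) : Prop :=
  forall u, P (H `&` [set om | X om = u]) =
    (((u \in C)%:R / #|C|%:R)%:E * P H)%E.

(* The random draws [D] and the output index [zeta] follow the sampling rules
   of the algorithm: each draw is uniform, conditionally on every possible
   outcome [w] of all the draws made before it.  A sample without replacement
   of size [N] is a uniform [N]-element subset of the indices; the size depends
   on the past through beta_s. *)
Record is_run (S : nat) d' (T : measurableType d') (P : probability T R)
    (D : T -> draws n B) (zeta : T -> 'I_S * 'I_m) : Prop := {
  measurable_anchor : forall s A, (s < S)%N ->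
    measurable [set om | anchor (D om) s = A] ;
  measurable_batch : forall s t (b : B.-tuple 'I_n), (s < S)%N -> (t < m)%N ->
    measurable [set om | batch (D om) s t = b] ;
  measurable_output : forall u, measurable [set om | zeta om = u] ;
  anchor_uniform : forall s (w : draws n B), (s < S)%N ->
    cond_uniform P [set om | agree_epochs s (D om) w]
      (fun om => anchor (D om) s)
      [set A : {set 'I_n} | #|A| == anchor_size (epoch w s).2]%SET ;
  batch_uniform : forall s t (w : draws n B), (s < S)%N -> (t < m)%N ->
    cond_uniform P [set om | agree_steps s t (D om) w]
      (fun om => batch (D om) s t) [set: B.-tuple 'I_n]%SET ;
  output_uniform : forall w : draws n B,
    cond_uniform P [set om | agree_epochs S (D om) w]
      zeta [set: 'I_S * 'I_m]%SET }.

End AbaSVRG.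

(* Main.v *)
Require Import Defs.
From mathcomp Require Import measurable_realfun ring lra.

(** Write F for the average of the f_i and v for the direction used at an
    iterate x.  Smoothness of F and the identity
    -2 <grad F(x), v> = |v - grad F(x)|^2 - |v|^2 - |grad F(x)|^2
    give, for every realization of the draws, the one-step inequality
    [descent_step]; summed over a run it compares the last value of F with
    F(x0) in terms of three sums over all K = S m steps: G of |grad F(x)|^2,
    V of |v|^2 and Q of the square errors |v - grad F(x)|^2 ([run_descent],
    [Ex_descent]).

    The point is to bound Q, in expectation, by a multiple of V and a term of
    order eps. Given the past, v - grad F(x) is the anchor error plus a centred
    mini-batch average with uncorrelated summands, so its mean square is at
    most the square anchor error plus L^2 |x - xt|^2 / B ([avg_dir_error]),
    where xt is the starting point of the epoch. The drift x - xt is a sum of at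
    most m directions times eta ([sum_drift]). The anchor is a sample without
    replacement, whose variance is at most sigma^2 / N and vanishes for an
    exhaustive sample ([avg_subset_enorm_sq]); by the choice of N this is at
    most (beta_s + eps) / alpha ([avg_anchor_error]). Finally, after the first
    epoch, beta_s is the mean square direction of the preceding epoch, so that
    the betas add up to at most beta_1 + V / m ([sum_beta]): this is why the
    adaptive sample sizes cost no more than another multiple of V. Altogether,
    in expectation, Q <= (eta^2 L^2 m^2 / B + 1 / alpha) V + 2 K eps / alpha
    ([Ex_sum_dir_error]). Inserting this in the descent inequality, where G
    can be dropped, leaves phi eta V <= F(x0) - F* + eta K eps / alpha, and
    G <= 2 Q + 2 V gives the bound on the mean G / K.

    Probability enters only through averaging one draw given the past.
    The draws of S epochs take finitely many values, so expectations are finite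
    weighted sums over histories ([Ex]), and the sampling rules say that a draw
    may be replaced by its uniform average ([Ex_cond_uniform]); the output index
    is independent of the draws and turns the expectation into G / K
    ([expectation_output]). *)

Set Implicit Arguments.
Unset Strict Implicit.
Unset Printing Implicit Defensive.

Local Open Scope classical_set_scope.
Local Open Scope ring_scope.

(** * Euclidean geometry of row vectors *)

Section Euclidean.
Context {R : realType} {d : nat}.
Implicit Types (u v : 'rV[R]_d) (a : R).

Definition dotv u v : R := \sum_(j < d) u ord0 j * v ord0 j.

Lemma enorm_sq v : enorm v ^+ 2 = \sum_(j < d) v ord0 j ^+ 2.
Proof. by rewrite sqr_sqrtr // sumr_ge0 // => j _; exact: sqr_ge0. Qed.

Lemma enorm_ge0 v : 0 <= enorm v.
Proof. exact: sqrtr_ge0. Qed.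

Lemma dotvv v : dotv v v = enorm v ^+ 2.
Proof. by rewrite enorm_sq; apply: eq_bigr => j _; rewrite expr2. Qed.

Lemma dotvC u v : dotv u v = dotv v u.
Proof. by apply: eq_bigr => j _; rewrite mulrC. Qed.

Lemma dotvDl u u' v : dotv (u + u') v = dotv u v + dotv u' v.
Proof. by rewrite -big_split; apply: eq_bigr => j _; rewrite mxE mulrDl. Qed.

Lemma dotvZl a u v : dotv (a *: u) v = a * dotv u v.
Proof. by rewrite mulr_sumr; apply: eq_bigr => j _; rewrite mxE mulrA. Qed.

Lemma dotvNl u v : dotv (- u) v = - dotv u v.
Proof. by rewrite -scaleN1r dotvZl mulN1r. Qed.

Lemma dotvBl u u' v : dotv (u - u') v = dotv u v - dotv u' v.
Proof. by rewrite dotvDl dotvNl. Qed.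

Lemma dotvZr a u v : dotv u (a *: v) = a * dotv u v.
Proof. by rewrite dotvC dotvZl dotvC. Qed.

Lemma dotv_suml (I : Type) (s : seq I) (F : I -> 'rV[R]_d) v :
  dotv (\sum_(i <- s) F i) v = \sum_(i <- s) dotv (F i) v.
Proof.
elim/big_rec2: _ => [|i x y _ <-]; last by rewrite dotvDl.
by rewrite /dotv big1 // => j _; rewrite mxE mul0r.
Qed.

Lemma enormZ_sq a v : enorm (a *: v) ^+ 2 = a ^+ 2 * enorm v ^+ 2.
Proof. by rewrite -!dotvv dotvZl dotvZr mulrA expr2. Qed.

Lemma enormB_sq u v :
  enorm (u - v) ^+ 2 = enorm u ^+ 2 - 2 * dotv u v + enorm v ^+ 2.
Proof.
rewrite -!dotvv dotvBl ![dotv _ (u - v)]dotvC !dotvBl (dotvC v u).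
by ring.
Qed.

Lemma enormZ a v : 0 <= a -> enorm (a *: v) = a * enorm v.
Proof.
move=> a0; apply/eqP; rewrite -(@eqrXn2 _ 2) ?mulr_ge0 ?enorm_ge0 //.
by rewrite enormZ_sq exprMn.
Qed.

Lemma dot0v v : dotv 0 v = 0.
Proof. by rewrite -(scale0r v) dotvZl mul0r. Qed.

Lemma enorm_eq0 v : enorm v = 0 -> v = 0.
Proof.
move=> v0; move: (enorm_sq v); rewrite v0 expr0n /= => /esym /eqP.
rewrite psumr_eq0 => [/allP z|j _]; last exact: sqr_ge0.
apply/rowP => j; rewrite mxE; apply/eqP; rewrite -sqrf_eq0.
exact: z (mem_index_enum _).
Qed.

(** The expansion of the nonnegative square of |v| u - |u| v. *)
Lemma cauchy_schwarz u v : dotv u v <= enorm u * enorm v.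
Proof.
have [/enorm_eq0 ->|u0] := eqVneq (enorm u) 0.
  by rewrite dot0v mulr_ge0 ?enorm_ge0.
have [/enorm_eq0 ->|v0] := eqVneq (enorm v) 0.
  by rewrite dotvC dot0v mulr_ge0 ?enorm_ge0.
have uv0 : 0 < enorm u * enorm v.
  by rewrite mulr_gt0 // lt_neqAle eq_sym ?u0 ?v0 enorm_ge0.
have : 0 <= enorm (enorm v *: u - enorm u *: v) ^+ 2 by exact: sqr_ge0.
rewrite enormB_sq !enormZ_sq dotvZl dotvZr => h.
rewrite -(ler_pM2l uv0); move: h; set a := enorm u; set b := enorm v; nra.
Qed.

(** Induction on the number of vectors, coordinate by coordinate; the step is
    the square of t x - s, where s is the sum of the first t terms. *)
Lemma enorm_sum_sq_le (t : nat) (F : 'I_t -> 'rV[R]_d) :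
  enorm (\sum_(i < t) F i) ^+ 2 <= t%:R * \sum_(i < t) enorm (F i) ^+ 2.
Proof.
under [X in _ <= _ * X]eq_bigr do rewrite enorm_sq.
rewrite enorm_sq exchange_big mulr_sumr ler_sum //= => j _.
rewrite summxE; elim: t F => [|t IH] F; first by rewrite !big_ord0 expr0n mul0r.
rewrite !big_ord_recr /= -natr1.
have /= := IH (fun i => F (widen_ord (leqnSn t) i)).
have : 0 <= \sum_(i < t) F (widen_ord (leqnSn t) i) ord0 j ^+ 2.
  by rewrite sumr_ge0 // => i _; exact: sqr_ge0.
move: (F ord_max _ _) (\sum_(_ < _) _ ord0 j) (\sum_(_ < _) _) => x s q q0 h.
have [t0|t0] := posnP t.
  move: h; rewrite t0 mul0r add0r mul1r => h.
  have /eqP : s ^+ 2 = 0 by apply/le_anti; rewrite h sqr_ge0.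
  by rewrite sqrf_eq0 => /eqP ->; rewrite add0r; lra.
have {}t0 : 0 < t%:R :> R by rewrite ltr0n.
rewrite -(ler_pM2l t0); move: (t%:R) t0 h => T t0 h.
have := sqr_ge0 (T * x - s).
have : 0 <= (T + 1) * (T * q - s ^+ 2) by rewrite mulr_ge0 ?subr_ge0 //; lra.
by nra.
Qed.

End Euclidean.

(** * Smooth functions *)

Section Smooth.
Context {R : realType} {d : nat}.
Implicit Types (h : 'rV[R]_d -> R) (x y v : 'rV[R]_d).

Lemma derive_grad h x v : differentiable h x -> 'D_v h x = dotv (grad h x) v.
Proof.
move=> dh; rewrite deriveE // {1}(row_sum_delta v) linear_sum.
apply: eq_bigr => j _; rewrite linearZ /= mxE deriveE //.
by rewrite mulrC.
Qed.

Lemma is_derive_line h x v (t : R) : (forall z, differentiable h z) ->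
  is_derive t 1 (fun s : R => h (x + s *: v)) (dotv (grad h (x + t *: v)) v).
Proof.
move=> dh.
have dl : is_diff t (fun s : R => x + s *: v) ( *:%R^~ v).
  by have := is_diffD (is_diff_cst x t) (is_diff_scalel t v); rewrite add0r.
have dd : differentiable (fun s : R => x + s *: v) t by case: dl.
apply: DeriveDef.
  by apply/derivable1_diffP; apply: (differentiable_comp dd (dh _)).
rewrite deriveE; last exact: (differentiable_comp dd (dh _)).
by rewrite (diff_comp dd (dh _)) /= diff_val scale1r -derive_grad // deriveE.
Qed.

(** The mean value theorem for
    t |-> h(x + t v) - t <grad h(x), v> - t^2 L |v|^2 / 2 with v = y - x, whose
    derivative is nonpositive for t >= 0 by Cauchy-Schwarz and the Lipschitz
    bound. *)
Lemma descent_lemma h (L : R) x y : (forall z, differentiable h z) ->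
  (forall z z', enorm (grad h z - grad h z') <= L * enorm (z - z')) ->
  h y <= h x + dotv (grad h x) (y - x) + L / 2 * enorm (y - x) ^+ 2.
Proof.
move=> dh lip; set v := y - x.
pose g (t : R) := h (x + t *: v) - t * dotv (grad h x) v
                  - t ^+ 2 * (L / 2 * enorm v ^+ 2).
pose dg (t : R) := dotv (grad h (x + t *: v)) v - dotv (grad h x) v
                  - t * (L * enorm v ^+ 2).
have gd (t : R) : is_derive t 1 g (dg t).
  rewrite /g /dg; have := is_derive_line x v t dh => hd.
  apply: is_derive_eq; rewrite !scaler0 !add0r /GRing.scale /= !mulr1.
  by field.
have [c /[!in_itv]/= /andP[c0 c1] gc] :
    exists2 c, c \in `[0, 1]%R & g 1 - g 0 = dg c * (1 - 0).
  apply: (MVT_segment (df := dg)) => //.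
  apply: continuous_subspaceT => t.
  by apply: differentiable_continuous; apply/derivable1_diffP; case: (gd t).
have dgc : dg c <= 0.
  rewrite /dg -dotvBl subr_le0; apply: (le_trans (cauchy_schwarz _ _)).
  have := lip (x + c *: v) x; rewrite addrAC subrr add0r enormZ // => l.
  have -> : c * (L * enorm v ^+ 2) = L * (c * enorm v) * enorm v by ring.
  by rewrite ler_wpM2r ?enorm_ge0.
move: gc; rewrite /g scale1r scale0r addr0 /v subrKC -/v.
by nra.
Qed.

Lemma grad_favg n (f : 'I_n -> 'rV[R]_d -> R) x :
  (forall i, differentiable (f i) x) ->
  grad (favg f) x = n%:R^-1 *: \sum_(i < n) grad (f i) x.
Proof.
move=> df; apply/rowP => j; rewrite !mxE summxE.
have -> : favg f = n%:R^-1 *: (\sum_(i < n) f i).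
  by apply/funext => y; rewrite /favg fctE fct_sumE.
rewrite deriveZ; last first.
  by apply: derivable_sum => i; exact/diff_derivable.
rewrite derive_sum => [|i]; last exact/diff_derivable.
by congr (_ *: _); apply: eq_bigr => i _; rewrite mxE.
Qed.

End Smooth.

(** * Variance of a uniform sample *)

Section Sampling.
Context {R : realType} {I : finType}.
Implicit Types (c : I -> R) (e : R).

Lemma big_tupleS (B : nat) (F : B.+1.-tuple I -> R) :
  \sum_b F b = \sum_i \sum_(b : B.-tuple I) F [tuple of i :: b].
Proof.
rewrite pair_big /= (reindex (fun p : I * B.-tuple I => [tuple of p.1 :: p.2])) //=.
exists (fun b => (thead b, [tuple of behead b])) => [[i b] _|b _] /=.
  by rewrite theadE; congr (_, _); apply: val_inj.
by rewrite [RHS]tuple_eta; apply: val_inj.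
Qed.

(** Draws with replacement are independent, so the centred summands are
    uncorrelated; the recursion over the draws moves the head of the tuple
    into the offset [e]. *)
Lemma sum_tuple_sq (B : nat) c e : \sum_i c i = 0 ->
  #|I|%:R * \sum_(b : B.-tuple I) (\sum_(i <- b) c i + e) ^+ 2
  = #|I|%:R ^+ B * (#|I|%:R * e ^+ 2 + B%:R * \sum_i c i ^+ 2).
Proof.
move=> c0; elim: B e => [|B IH] e.
  rewrite expr0 mul1r mul0r addr0; congr (_ * _).
  rewrite (big_pred1 [tuple]) => [|b]; first by rewrite big_nil add0r.
  by rewrite [b]tuple0; exact/esym/eqxx.
have sq : \sum_i (c i + e) ^+ 2 = \sum_i c i ^+ 2 + #|I|%:R * e ^+ 2.
  under eq_bigr do rewrite sqrrD.
  rewrite !big_split /= sumr_const -mulr_suml c0 mul0r !addr0.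
  by rewrite mulr_natl.
rewrite big_tupleS [LHS]mulr_sumr.
under eq_bigr => i _.
  under eq_bigr do rewrite big_cons -addrA addrC -addrA [e + _]addrC.
  rewrite IH; over.
rewrite -mulr_sumr big_split /= sumr_const -mulr_sumr sq -natr1.
rewrite -[X in _ * (_ + X) = _]mulr_natl -[#|xpredT|]/#|I|.
by rewrite [X in _ = X * _]exprS; ring.
Qed.

Lemma avg_tuple_sq (B : nat) (a : I -> R) e :
  let mu := #|I|%:R^-1 * \sum_i a i in
  (0 < #|I|)%N -> (0 < B)%N ->
  #|{: B.-tuple I}|%:R^-1 *
    \sum_(b : B.-tuple I) (B%:R^-1 * \sum_(i <- b) a i - mu + e) ^+ 2
  = e ^+ 2 + B%:R^-1 * (#|I|%:R^-1 * \sum_i (a i - mu) ^+ 2).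
Proof.
move=> mu I0 B0.
have In0 : #|I|%:R != 0 :> R by rewrite pnatr_eq0 -lt0n.
have Bn0 : B%:R != 0 :> R by rewrite pnatr_eq0 -lt0n.
have c0 : \sum_i (a i - mu) = 0.
  by rewrite sumrB sumr_const -[X in _ - X]mulr_natl /mu mulVKf // subrr.
have -> : \sum_(b : B.-tuple I) (B%:R^-1 * \sum_(i <- b) a i - mu + e) ^+ 2
  = B%:R ^- 2 * \sum_(b : B.-tuple I) (\sum_(i <- b) (a i - mu) + B%:R * e) ^+ 2.
  rewrite mulr_sumr; apply: eq_bigr => b _; rewrite -exprVn -exprMn; congr (_ ^+ 2).
  rewrite sumrB big_const_seq count_predT size_tuple iter_addr_0 -mulr_natl.
  by field.
have := sum_tuple_sq B (B%:R * e) c0.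
rewrite card_tuple natrX.
move: (\sum_b _) (\sum_i (_ - _) ^+ 2) => X Q h.
have pn0 : #|I|%:R ^+ B != 0 :> R by rewrite expf_neq0.
apply: (mulfI pn0); apply: (mulfI In0).
by rewrite mulVKf // mulrCA h; field; rewrite In0.
Qed.

(** Centred terms over a subset add up to the opposite of the sum over its
    complement.  Expanding the square of the latter leaves, for every pair
    (i, j), the number K i j of sets of size [N] that avoid both points.  It
    depends only on whether i = j, so up to diagonal terms the sum is a multiple
    of the square of the total, which is zero. *)
Lemma sum_subset_sq (N : nat) c : \sum_i c i = 0 ->
  \sum_(A in [set A : {set I} | #|A| == N]%SET) (\sum_(i in A) c i) ^+ 2
  = ('C(#|I|.-1, N)%:R - 'C(#|I|.-2, N)%:R) * \sum_i c i ^+ 2.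
Proof.
move=> c0.
pose K (i j : I) : R := #|[set A : {set I} | A \subset ~: [set i; j] & #|A| == N]%SET|%:R.
have KE i j : K i j = if i == j then 'C(#|I|.-1, N)%:R else 'C(#|I|.-2, N)%:R.
  rewrite /K cards_draws cardsCs finset.setCK cards2; case: eqVneq => _ /=.
    by rewrite subn1.
  by rewrite subn2.
have -> : \sum_(A in [set A : {set I} | #|A| == N]%SET) (\sum_(i in A) c i) ^+ 2
   = \sum_i \sum_j c i * c j * K i j.
  transitivity (\sum_(A in [set A : {set I} | #|A| == N]%SET)
     \sum_i \sum_j c i * c j * (A \subset ~: [set i; j]%SET)%:R).
    apply: eq_bigr => A _.
    have -> : \sum_(i in A) c i = - \sum_(i | i \notin A) c i.
      by apply/eqP; rewrite -addr_eq0 -[X in _ == X]c0 [eqbRHS](bigID (mem A)).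
    have sub i j : (A \subset ~: [set i; j]%SET) = (i \notin A) && (j \notin A).
      by rewrite finset.subsetC finset.subUset !finset.sub1set !finset.in_setC.
    rewrite sqrrN expr2 mulr_suml [LHS]big_mkcond; apply: eq_bigr => i _ /=.
    under [RHS]eq_bigr do rewrite sub.
    case: (i \notin A); last by rewrite big1 // => j _; rewrite mulr0.
    rewrite mulr_sumr big_mkcond; apply: eq_bigr => j _ /=.
    by case: (j \notin A); rewrite ?mulr1 ?mulr0.
  rewrite exchange_big; apply: eq_bigr => i _ /=.
  rewrite exchange_big; apply: eq_bigr => j _ /=.
  rewrite -mulr_sumr; congr (_ * _); rewrite /K -sum1_card natr_sum.
  rewrite big_mkcond [RHS]big_mkcond /=; apply: eq_bigr => A _.
  by rewrite !inE andbC; case: (_ == _); case: (_ \subset _).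
have -> : \sum_i \sum_j c i * c j * K i j
   = \sum_i \sum_j c i * c j * 'C(#|I|.-2, N)%:R
     + \sum_i c i ^+ 2 * ('C(#|I|.-1, N)%:R - 'C(#|I|.-2, N)%:R).
  rewrite -big_split; apply: eq_bigr => i _ /=.
  rewrite (bigD1 i) //= [in RHS](bigD1 i) //= KE eqxx addrAC.
  congr (_ + _); first by ring.
  by apply: eq_bigr => j; rewrite KE eq_sym => /negPf ->.
rewrite big1 ?add0r => [|i _]; first by rewrite -mulr_suml mulrC.
by rewrite -mulr_suml -mulr_sumr c0 mulr0 mul0r.
Qed.

(** The difference is the number of terms times the square of the mean. *)
Lemma sum_centred_sq (a : I -> R) :
  let mu := #|I|%:R^-1 * \sum_i a i in
  (0 < #|I|)%N -> \sum_i (a i - mu) ^+ 2 <= \sum_i a i ^+ 2.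
Proof.
move=> mu I0; have In0 : #|I|%:R != 0 :> R by rewrite pnatr_eq0 -lt0n.
have -> : \sum_i (a i - mu) ^+ 2 = \sum_i a i ^+ 2 - #|I|%:R * mu ^+ 2.
  under eq_bigr do rewrite sqrrB.
  rewrite big_split sumrB /= sumr_const sumrMnl -mulr_suml.
  have -> : \sum_i a i = #|I|%:R * mu by rewrite /mu mulVKf.
  rewrite -[_ *+ #|_|]mulr_natl -[#|xpredT|]/#|I|; ring.
by rewrite gerBl mulr_ge0 ?sqr_ge0.
Qed.

(** For N < n, Pascal's rule turns the difference of binomials into
    'C(n - 2, N - 1) <= 'C(n - 1, N - 1) = (N / n) 'C(n, N); for N = n both
    binomials vanish, as an exhaustive sample has no error. *)
Lemma subset_variance_factor (N n : nat) : (0 < N <= n)%N ->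
  'C(n, N)%:R^-1 * (N%:R ^- 2 * ('C(n.-1, N)%:R - 'C(n.-2, N)%:R))
  <= (N < n)%N%:R * (N%:R^-1 * n%:R^-1) :> R.
Proof.
case: N => // N; case: n => // n /=; rewrite ltnS leq_eqVlt => /orP[/eqP <-|].
  rewrite ltnn [in X in X - _]bin_small // [in X in _ - X]bin_small ?ltnS ?leq_pred //.
  by rewrite subrr !mulr0 mul0r.
case: n => // n Nn; rewrite ltnS Nn mul1r /=.
have -> : 'C(n.+1, N.+1)%:R - 'C(n, N.+1)%:R = 'C(n, N)%:R :> R.
  by rewrite binS natrD addrAC subrr add0r.
have C0 : 0 < 'C(n.+2, N.+1)%:R :> R by rewrite ltr0n bin_gt0 ltnS ltnW.
have N0 : 0 < N.+1%:R :> R by rewrite ltr0n.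
have n0 : 0 < n.+2%:R :> R by rewrite ltr0n.
have diag : n.+2%:R * 'C(n.+1, N)%:R = N.+1%:R * 'C(n.+2, N.+1)%:R :> R.
  by rewrite -!natrM; congr _%:R; exact: mul_bin_diag.
have le : 'C(n, N)%:R <= 'C(n.+1, N)%:R :> R by rewrite ler_nat leq_bin2l.
rewrite ler_pdivrMl // ler_pdivrMl ?exprn_gt0 //.
have -> : N.+1%:R ^+ 2 * ('C(n.+2, N.+1)%:R * (N.+1%:R^-1 * n.+2%:R^-1))
  = n.+2%:R^-1 * (N.+1%:R * 'C(n.+2, N.+1)%:R) :> R by field; rewrite !gt_eqF.
by rewrite -diag mulKf // gt_eqF.
Qed.

Lemma avg_subset_sq (N : nat) (a : I -> R) :
  let mu := #|I|%:R^-1 * \sum_i a i in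
  let C := [set A : {set I} | #|A| == N]%SET in
  (0 < N <= #|I|)%N ->
  #|C|%:R^-1 * \sum_(A in C) (N%:R^-1 * \sum_(i in A) a i - mu) ^+ 2
  <= (N < #|I|)%N%:R * (N%:R^-1 * (#|I|%:R^-1 * \sum_i (a i - mu) ^+ 2)).
Proof.
move=> mu C NI; have /andP[N0 NleI] := NI; have I0 := leq_trans N0 NleI.
have In0 : #|I|%:R != 0 :> R by rewrite pnatr_eq0 -lt0n.
have Nn0 : N%:R != 0 :> R by rewrite pnatr_eq0 -lt0n.
have c0 : \sum_i (a i - mu) = 0.
  by rewrite sumrB sumr_const -[X in _ - X]mulr_natl /mu mulVKf // subrr.
have -> : \sum_(A in C) (N%:R^-1 * \sum_(i in A) a i - mu) ^+ 2
  = N%:R ^- 2 * \sum_(A in C) (\sum_(i in A) (a i - mu)) ^+ 2.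
  rewrite mulr_sumr; apply: eq_bigr => A; rewrite inE => /eqP AN.
  rewrite -exprVn -exprMn; congr (_ ^+ 2).
  by rewrite sumrB sumr_const AN -mulr_natl; field.
rewrite sum_subset_sq // /C card_draws !mulrA ler_wpM2r //.
  by rewrite sumr_ge0 // => i _; exact: sqr_ge0.
by rewrite -!mulrA; exact: subset_variance_factor.
Qed.

Context {d : nat}.
Implicit Types (v : I -> 'rV[R]_d).

(** In the application [e] is the anchor error, fixed before the mini-batch is
    drawn: it adds up orthogonally with the sampling error. *)
Lemma avg_tuple_enorm_sq (B : nat) v (e : 'rV[R]_d) :
  let mu := #|I|%:R^-1 *: \sum_i v i in
  (0 < #|I|)%N -> (0 < B)%N ->
  #|{: B.-tuple I}|%:R^-1 *
    \sum_(b : B.-tuple I) enorm (B%:R^-1 *: \sum_(i <- b) v i - mu + e) ^+ 2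
  <= enorm e ^+ 2 + B%:R^-1 * (#|I|%:R^-1 * \sum_i enorm (v i) ^+ 2).
Proof.
move=> mu I0 B0.
under eq_bigr do rewrite enorm_sq.
rewrite exchange_big mulr_sumr /= enorm_sq.
under [X in _ <= _ + _ * (_ * X)]eq_bigr do rewrite enorm_sq.
rewrite [X in _ <= _ + _ * (_ * X)]exchange_big /= !mulr_sumr -big_split /=.
apply: ler_sum => j _.
under eq_bigr do rewrite !mxE [in X in X ^+ 2]summxE [in X in X ^+ 2]summxE.
rewrite avg_tuple_sq // lerD2l ler_wpM2l ?invr_ge0 // ler_wpM2l ?invr_ge0 //.
exact: sum_centred_sq.
Qed.

Lemma avg_subset_enorm_sq (N : nat) v :
  let mu := #|I|%:R^-1 *: \sum_i v i in
  let C := [set A : {set I} | #|A| == N]%SET in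
  (0 < N <= #|I|)%N ->
  #|C|%:R^-1 * \sum_(A in C) enorm (N%:R^-1 *: \sum_(i in A) v i - mu) ^+ 2
  <= (N < #|I|)%N%:R * (N%:R^-1 * (#|I|%:R^-1 * \sum_i enorm (v i - mu) ^+ 2)).
Proof.
move=> mu C NI.
under eq_bigr do rewrite enorm_sq.
rewrite exchange_big mulr_sumr /=.
under [X in _ <= _ * (_ * (_ * X))]eq_bigr do rewrite enorm_sq.
rewrite [X in _ <= _ * (_ * (_ * X))]exchange_big /= !mulr_sumr.
apply: ler_sum => j _.
under eq_bigr do rewrite !mxE !summxE.
rewrite (le_trans (avg_subset_sq _ NI)) //.
by under [X in _ <= _ * (_ * (_ * X))]eq_bigr do rewrite !mxE summxE.
Qed.

End Sampling.

(** * Random variables with finitely many values *)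

Section FiniteValued.
Context {R : realType} {d' : measure_display} {T : measurableType d'}.
Context (P : probability T R) {V : finType} (Y : T -> V).
Context (mY : forall v, measurable [set om | Y om = v]).

Definition pmf (v : V) : R := fine (P [set om | Y om = v]).

Lemma pmfE v : P [set om | Y om = v] = (pmf v)%:E.
Proof. by rewrite fineK ?fin_num_measure. Qed.

Lemma pmf_ge0 v : 0 <= pmf v.
Proof. by rewrite fine_ge0. Qed.

(** The integrand is a finite combination of indicators of the fibres of [Y]. *)
Lemma expectation_finite (F : V -> R) : (forall v, 0 <= F v) ->
  ('E_P[F \o Y] = (\sum_v pmf v * F v)%:E)%E.
Proof.
move=> F0; rewrite unlock.
transitivity (\int[P]_om (\sum_v (F v * \1_[set om | Y om = v] om)%:E))%E.
  apply: eq_integral => om _ /=; rewrite sumEFin; congr _%:E.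
  rewrite (bigD1 (Y om)) //= indicE mem_set // mulr1 big1 ?addr0 // => v vY.
  by rewrite indicE memNset ?mulr0 //= => /esym/eqP; rewrite (negPf vY).
rewrite ge0_integral_sum //=.
- rewrite -sumEFin; apply: eq_bigr => v _.
  under eq_integral do rewrite EFinM.
  rewrite ge0_integralZl_EFin //.
  + rewrite integral_indic // setIT mulrC EFinM -pmfE muleC.
    by [].
  + by apply/measurable_EFinP; apply: measurable_indic.
- move=> v; apply/measurable_EFinP; apply: measurable_funM; first exact: measurable_cst.
  by apply: measurable_indic.
- by move=> v ? _; rewrite lee_fin mulr_ge0.
Qed.

Lemma prob_finite (Q : {pred V}) :
  P [set om | Y om \in Q] = (\sum_(v in Q) pmf v)%:E.
Proof.
have mQ : measurable [set om | Y om \in Q].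
  rewrite (_ : [set _ | _] = \big[setU/set0]_(v <- enum Q) [set om | Y om = v]).
    by apply: bigsetU_measurable => v _.
  rewrite -bigcup_seq; apply/seteqP; split => om /=.
    by move=> h; exists (Y om) => //=; rewrite mem_enum.
  by case=> v /=; rewrite mem_enum => vQ ->.
have -> : P [set om | Y om \in Q] = ('E_P[(fun v => (v \in Q)%:R) \o Y])%E.
  rewrite unlock -[in LHS](setIT [set om | _]) -integral_indic //.
  apply: eq_integral => om _; rewrite indicE /=; congr ((nat_of_bool _)%:R)%:E.
  by apply/idP/idP; rewrite inE.
rewrite expectation_finite //; congr _%:E; rewrite [RHS]big_mkcond.
by apply: eq_bigr => v _; case: (v \in Q); rewrite ?mulr1 ?mulr0.
Qed.

End FiniteValued.

(** Averaging one draw given the past: [e] relates outcomes with the same past,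
    and given the past of [v] the draw [X] is uniform on [C v].  The sum splits
    over the classes of [e]; within a class [F] and [C] are those of a
    representative, so only the conditional law of [X] matters. *)
Lemma sum_cond_uniform (R : realType) (V U : finType) (p : V -> R) (e : rel V)
    (X : V -> U) (C : V -> {set U}) (F : V -> U -> R) :
  equivalence_rel e ->
  (forall v v', e v v' -> C v = C v') ->
  (forall v v', e v v' -> F v =1 F v') ->
  (forall v u, \sum_(v' | e v v' && (X v' == u)) p v' =
      (u \in C v)%:R / #|C v|%:R * \sum_(v' | e v v') p v') ->
  \sum_v p v * F v (X v) =
  \sum_v p v * (#|C v|%:R^-1 * \sum_(u in C v) F v u).
Proof.
move=> eE CE FE unif.
(* A class is labelled by an element picked in it, which depends on the class
   only. *)
pose cls v := [pick v' | e v v'].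
have clsE v v' : (cls v == cls v') = e v v'.
  have [vv'|nvv'] := boolP (e v v').
    by apply/eqP/eq_pick => z; apply: (eE v v' z).2.
  apply/negbTE; move: nvv'; apply: contra; rewrite /cls.
  case: pickP => [z ez|/(_ v)]; last by rewrite (eE v v v).1.
  case: pickP => [z' ez' /eqP[zz']|//]; subst z'.
  by rewrite ((eE v z v').2 ez) -((eE v' z v').2 ez') (eE v' v' v').1.
rewrite (partition_big cls predT) //= [RHS](partition_big cls predT) //=.
apply: eq_bigr => j _.
have [v0 /eqP v0j|none] := pickP (fun v => cls v == j); last first.
  by rewrite !big_pred0.
have cv v : (cls v == j) = e v0 v by rewrite -v0j eq_sym clsE.
rewrite (eq_bigl _ _ cv) [RHS](eq_bigl _ _ cv).
transitivity (\sum_(v | e v0 v) p v * F v0 (X v)).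
  by apply: eq_bigr => v ev; rewrite (FE _ _ ev).
transitivity (\sum_(v | e v0 v) p v * (#|C v0|%:R^-1 * \sum_(u in C v0) F v0 u)).
  transitivity (\sum_u (\sum_(v | e v0 v && (X v == u)) p v) * F v0 u).
    rewrite (partition_big X predT) //=; apply: eq_bigr => u _.
    by rewrite mulr_suml; apply: eq_bigr => v /andP[_ /eqP ->].
  rewrite -[RHS]mulr_suml mulrA.
  under eq_bigr do rewrite unif.
  rewrite [X in _ * X]big_mkcond mulr_sumr; apply: eq_bigr => u _.
  by case: (u \in C v0); rewrite ?mulr0 ?mul0r // div1r [in LHS](mulrC _^-1).
apply: eq_bigr => v ev; rewrite (CE _ _ ev).
by congr (_ * (_ * _)); apply: eq_bigr => u _; exact: FE.
Qed.

(** * Runs of the algorithm *)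

Section Agreement.
Context {n B m : nat}.
Implicit Types w : draws n B.

Lemma agree_epochs_sym s w w' : agree_epochs m s w w' -> agree_epochs m s w' w.
Proof. by move=> h r /h [e hb]; split=> // t /hb ->. Qed.

Lemma agree_epochs_trans s w1 w2 w3 :
  agree_epochs m s w1 w2 -> agree_epochs m s w2 w3 -> agree_epochs m s w1 w3.
Proof.
move=> h12 h23 r rs; have [-> h] := h12 r rs; have [-> h'] := h23 r rs.
by split=> // t tm; rewrite h ?h'.
Qed.

Lemma agree_steps_sym s t w w' : agree_steps m s t w w' -> agree_steps m s t w' w.
Proof. by case=> /agree_epochs_sym ? e h; split=> // r /h ->. Qed.

Lemma agree_steps_trans s t w1 w2 w3 :
  agree_steps m s t w1 w2 -> agree_steps m s t w2 w3 -> agree_steps m s t w1 w3.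
Proof.
move=> [a12 b12 c12] [a23 b23 c23]; split; first exact: agree_epochs_trans a23.
  by rewrite b12.
by move=> r rt; rewrite c12 ?c23.
Qed.

Lemma agree_epochs_le s r w w' : (r <= s)%N ->
  agree_epochs m s w w' -> agree_epochs m r w w'.
Proof. by move=> rs h q qr; apply: h; exact: leq_trans qr rs. Qed.

Lemma agree_epochsW s t w w' : (t <= m)%N ->
  agree_epochs m s.+1 w w' -> agree_steps m s t w w'.
Proof.
move=> tm h; have [hA hb] := h s (leqnn _); split=> //.
  exact: agree_epochs_le h.
by move=> r rt; apply: hb; exact: leq_trans rt tm.
Qed.

End Agreement.

Section Trajectory.
Context {R : realType} {d n m B : nat}.
Context (f : 'I_n -> 'rV[R]_d -> R) (x0 : 'rV[R]_d) (eta beta1 : R).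
Implicit Types w : draws n B.

(** The state reached after some draws depends on these draws only; this makes
    conditioning on the past meaningful for the quantities below. *)
Lemma inner_ext xt A (b b' : nat -> B.-tuple 'I_n) t :
  (forall r, (r < t)%N -> b r = b' r) ->
  inner f eta xt A b t = inner f eta xt A b' t.
Proof.
elim: t => [_|t IH h]; first reflexivity.
have e : inner f eta xt A b t = inner f eta xt A b' t.
  by apply: IH => r rt; apply: h; exact: ltn_trans rt _.
by rewrite /= e (h t (ltnSn t)).
Qed.

Lemma epoch_ext s w w' : agree_epochs m s w w' ->
  epoch m f x0 eta beta1 w s = epoch m f x0 eta beta1 w' s.
Proof.
elim: s => [_|s IH h]; first reflexivity.
have [eA eb] := h s (ltnSn s).
have ei xt A t : (t <= m)%N ->
    inner f eta xt A (batch w s) t = inner f eta xt A (batch w' s) t.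
  by move=> tm; apply: inner_ext => r rt; apply: eb; exact: leq_trans rt tm.
rewrite /= (IH (agree_epochs_le (leqnSn s) h)) eA ei; last exact: leqnn.
congr (_, _ * _); apply: eq_bigr => t _.
by rewrite ei ?eb // ltnW.
Qed.

Lemma iterate_ext s t w w' : agree_steps m s t w w' ->
  iterate m f x0 eta beta1 w s t = iterate m f x0 eta beta1 w' s t.
Proof.
by case=> h hA hb; rewrite /iterate (epoch_ext h) hA; exact: inner_ext.
Qed.

End Trajectory.

Section Run.
Context {R : realType} {d n m B S : nat}.
Context (f : 'I_n -> 'rV[R]_d -> R) (x0 : 'rV[R]_d).
Context (eta cb ce beta1 sigma eps : R) (n_gt0 : (0 < n)%N).
Context {d' : measure_display} {T : measurableType d'} (P : probability T R).
Context (D : T -> draws n B) (zeta : T -> 'I_S * 'I_m).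
Context (run : is_run f x0 eta cb ce beta1 sigma eps P D zeta).

(** The values of the draws of the first [S] epochs.  Unlike [draws], this type
    is finite, and it determines every iterate of the run. *)
Definition history : finType :=
  ({ffun 'I_S -> {set 'I_n}} * {ffun 'I_S * 'I_m -> B.-tuple 'I_n})%type.

(** A value for the steps beyond the end of a history. *)
Definition default_batch : B.-tuple 'I_n := nseq_tuple B (Ordinal n_gt0).

Definition draws_of (h : history) : draws n B := Draws
  (fun s => if insub s is Some i then h.1 i else finset.set0)
  (fun s t => if (insub s, insub t) is (Some i, Some j) then h.2 (i, j)
              else default_batch).

Definition history_of (w : draws n B) : history :=
  ([ffun i : 'I_S => anchor w i], [ffun p : 'I_S * 'I_m => batch w p.1 p.2]).

Lemma history_ofK w : agree_epochs m S (draws_of (history_of w)) w.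
Proof.
move=> s sS; split=> [|t tm] /=; first by rewrite insubT /= ffunE.
by rewrite !insubT /= ffunE.
Qed.

Lemma history_ofP (w w' : draws n B) :
  agree_epochs m S w w' <-> history_of w = history_of w'.
Proof.
split=> [h|e].
  congr (_, _); apply/ffunP => i; rewrite !ffunE; first by case: (h i).
  by case: (h i.1) => // _ ->.
apply: (agree_epochs_trans (agree_epochs_sym (history_ofK w))).
by rewrite e; exact: history_ofK.
Qed.

Lemma draws_ofK : cancel draws_of history_of.
Proof.
have ordK k (i : 'I_k) : insub (nat_of_ord i) = Some i by exact: valK.
move=> [a b]; congr (_, _); apply/ffunP => i; rewrite ffunE /=.
  by rewrite ordK.
by case: i => i j; rewrite /= !ordK.
Qed.

Lemma measurable_history (h : history) :
  measurable [set om | history_of (D om) = h].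
Proof.
have -> : [set om | history_of (D om) = h] =
  (\bigcap_(i in [set: 'I_S]) [set om | anchor (D om) i = h.1 i]) `&`
  (\bigcap_(p in [set: 'I_S * 'I_m]) [set om | batch (D om) p.1 p.2 = h.2 p]).
  apply/seteqP; split => om /=.
    by move=> <-; split=> p _; rewrite ffunE.
  case: h => a b /= [ha hb]; congr (_, _); apply/ffunP => p; rewrite ffunE.
    exact: ha.
  exact: hb.
apply: measurableI; apply: fin_bigcap_measurable => // p _.
  exact: (measurable_anchor run).
exact: (measurable_batch run).
Qed.

Definition prob_history : history -> R := pmf P (fun om => history_of (D om)).

(** This is the expectation of F(D) when [F] looks at the first [S] epochs only.
    As a finite weighted sum it is linear and monotone without integrability
    conditions. *)
Definition Ex (F : draws n B -> R) : R :=
  \sum_h prob_history h * F (draws_of h).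

Lemma prob_history_ge0 h : 0 <= prob_history h.
Proof. exact: pmf_ge0. Qed.

Lemma Ex_le F G : (forall w, F w <= G w) -> Ex F <= Ex G.
Proof.
by move=> FG; apply: ler_sum => h _; rewrite ler_wpM2l ?prob_history_ge0.
Qed.

Lemma Ex_ge0 (F : draws n B -> R) : (forall w, 0 <= F w) -> 0 <= Ex F.
Proof. by move=> F0; apply: sumr_ge0 => h _; rewrite mulr_ge0 ?prob_history_ge0. Qed.

Lemma ExD F G : Ex (fun w => F w + G w) = Ex F + Ex G.
Proof. by rewrite -big_split; apply: eq_bigr => h _; rewrite mulrDr. Qed.

Lemma ExZ a F : Ex (fun w => a * F w) = a * Ex F.
Proof. by rewrite mulr_sumr; apply: eq_bigr => h _; rewrite mulrCA. Qed.

Lemma Ex_sum (I : Type) (r : seq I) (F : I -> draws n B -> R) :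
  Ex (fun w => \sum_(i <- r) F i w) = \sum_(i <- r) Ex (F i).
Proof.
by rewrite exchange_big; apply: eq_bigr => h _; rewrite mulr_sumr.
Qed.

Lemma Ex_cst a : Ex (fun=> a) = a.
Proof.
rewrite /Ex -mulr_suml; suff -> : \sum_h prob_history h = 1 by rewrite mul1r.
apply: EFin_inj.
rewrite -(prob_finite (Y := fun om => history_of (D om)) P measurable_history predT).
by rewrite -(probability_setT P); congr (P _); apply/seteqP; split.
Qed.

(** The common form of the rules for anchors and mini-batches: [H w w'] says
    that [w] and [w'] have the same past, and [X] reads the draw that comes
    next.  Events about [D] are rewritten as events about its history, where
    [sum_cond_uniform] applies. *)
Lemma Ex_cond_uniform (U : finType) (H : draws n B -> draws n B -> Prop)
    (X : draws n B -> U) (C : draws n B -> {set U}) (F : draws n B -> U -> R) :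
  (forall w, H w w) -> (forall w w', H w w' -> H w' w) ->
  (forall w1 w2 w3, H w1 w2 -> H w2 w3 -> H w1 w3) ->
  (forall w w', agree_epochs m S w w' -> H w w' /\ X w = X w') ->
  (forall w w', H w w' -> C w = C w') ->
  (forall w w', H w w' -> F w =1 F w') ->
  (forall w, cond_uniform P [set om | H (D om) w] (fun om => X (D om)) (C w)) ->
  Ex (fun w => F w (X w)) = Ex (fun w => #|C w|%:R^-1 * \sum_(u in C w) F w u).
Proof.
move=> Hr Hs Ht HX HC HF unif.
pose e h h' := `[< H (draws_of h') (draws_of h) >].
apply: (@sum_cond_uniform _ _ _ prob_history e (fun h => X (draws_of h))
  (fun h => C (draws_of h)) (fun h => F (draws_of h))).
- move=> h1 h2 h3; split; first exact/asboolP.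
  move=> /asboolP h12; apply/asboolP/asboolP => h; first exact: Ht h (Hs _ _ h12).
  exact: Ht h h12.
- by move=> h h' /asboolP /Hs; exact: HC.
- by move=> h h' /asboolP /Hs; exact: HF.
move=> h u; have := unif (draws_of h) u.
have DH om : H (draws_of (history_of (D om))) (draws_of h) <-> H (D om) (draws_of h).
  have [hr _] := HX _ _ (history_ofK (D om)).
  by split; apply: Ht => //; exact: Hs.
have -> : [set om | H (D om) (draws_of h)] =
   [set om | history_of (D om) \in [pred h' | e h h']].
  by apply/seteqP; split => om /=; rewrite inE => /DH.
have -> : [set om | history_of (D om) \in [pred h' | e h h']] `&` [set om | X (D om) = u]
  = [set om | history_of (D om) \in [pred h' | e h h' && (X (draws_of h') == u)]].
  apply/seteqP; split => om /=; have [_ XD] := HX _ _ (history_ofK (D om)).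
    move=> -[]; rewrite !inE => h0 <-.
    by apply/andP; split; [exact/asboolP|rewrite XD].
  rewrite inE => /andP[/asboolP h0 /eqP <-]; rewrite XD.
  by split=> //; rewrite inE.
rewrite !prob_finite; [|exact: measurable_history..].
by rewrite -EFinM => pE; exact: EFin_inj pE.
Qed.

Lemma Ex_batch s t (F : draws n B -> B.-tuple 'I_n -> R) :
  (s < S)%N -> (t < m)%N ->
  (forall w w', agree_steps m s t w w' -> F w =1 F w') ->
  Ex (fun w => F w (batch w s t)) =
  Ex (fun w => #|{: B.-tuple 'I_n}|%:R^-1 * \sum_(b : B.-tuple 'I_n) F w b).
Proof.
move=> sS tm HF.
rewrite (Ex_cond_uniform (H := agree_steps m s t)
  (C := fun=> [set: B.-tuple 'I_n]%SET)) //.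
- apply: eq_bigr => h _; rewrite cardsT; congr (_ * (_ * _)).
  by apply: eq_bigl => b; rewrite inE.
- by move=> w w'; exact: agree_steps_sym.
- by move=> w1 w2 w3; exact: agree_steps_trans.
- move=> w w' h; split; last by have [_ ->] := h s sS.
  by apply: agree_epochsW (ltnW tm) _; exact: agree_epochs_le h.
- by move=> w; exact: (batch_uniform run).
Qed.

Lemma Ex_anchor s (F : draws n B -> {set 'I_n} -> R) : (s < S)%N ->
  (forall w w', agree_epochs m s w w' -> F w =1 F w') ->
  let C w := [set A : {set 'I_n} |
    #|A| == anchor_size n cb ce sigma eps (epoch m f x0 eta beta1 w s).2]%SET in
  Ex (fun w => F w (anchor w s)) =
  Ex (fun w => #|C w|%:R^-1 * \sum_(A in C w) F w A).
Proof.
move=> sS HF C.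
apply: (Ex_cond_uniform (H := agree_epochs m s)) => //.
- by move=> w w'; exact: agree_epochs_sym.
- by move=> w1 w2 w3; exact: agree_epochs_trans.
- move=> w w' h; split; last by have [->] := h s sS.
  exact: agree_epochs_le (ltnW sS) h.
- by move=> w w' h; rewrite /C (epoch_ext _ _ _ _ h).
- by move=> w; exact: (anchor_uniform run).
Qed.

(** The output index is uniform given all the draws, so integrating over it
    averages over all iterates. *)
Lemma expectation_output (F : draws n B -> 'I_S -> 'I_m -> R) :
  (forall w w', agree_epochs m S w w' -> F w =2 F w') ->
  (forall w s t, 0 <= F w s t) ->
  ('E_P[fun om => F (D om) (zeta om).1 (zeta om).2] =
   (Ex (fun w => (S * m)%:R^-1 * \sum_(s < S) \sum_(t < m) F w s t))%:E)%E.
Proof.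
move=> HF F0.
pose Y om : history * ('I_S * 'I_m) := (history_of (D om), zeta om).
have YE h u : [set om | Y om = (h, u)] =
  [set om | history_of (D om) = h] `&` [set om | zeta om = u].
  by apply/seteqP; split => om /=; [case=> -> ->|case=> <- <-].
have mY v : measurable [set om | Y om = v].
  case: v => h u; rewrite YE; apply: measurableI; first exact: measurable_history.
  exact: (measurable_output run).
have -> : (fun om => F (D om) (zeta om).1 (zeta om).2) =
  (fun v => F (draws_of v.1) v.2.1 v.2.2) \o Y.
  by apply/funext => om /=; rewrite (HF _ _ (history_ofK (D om))).
rewrite expectation_finite //; congr _%:E.
transitivity (\sum_h \sum_u pmf P Y (h, u) * F (draws_of h) u.1 u.2).
  by rewrite pair_big; apply: eq_bigr => -[].
apply: eq_bigr => h _; rewrite pair_big /= !mulr_sumr; apply: eq_bigr => u _.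
rewrite mulrA; congr (_ * _); apply: EFin_inj.
rewrite -pmfE // YE.
have := output_uniform run (draws_of h) u.
have -> : [set om | agree_epochs m S (D om) (draws_of h)] =
  [set om | history_of (D om) = h].
  by apply/seteqP; split => om /=; rewrite history_ofP draws_ofK.
rewrite /= => ->; rewrite inE cardsT card_prod !card_ord div1r muleC.
by rewrite EFinM -pmfE //; exact: measurable_history.
Qed.

End Run.

(** * Error of the search directions *)

Section Directions.
Context {R : realType} {d n : nat} (f : 'I_n -> 'rV[R]_d -> R) (L sigma : R).
Context (n_gt0 : (0 < n)%N).
Context (f_diff : forall i (x : 'rV[R]_d), differentiable (f i) x).
Context (f_lip : forall i x y,
  enorm (grad (f i) x - grad (f i) y) <= L * enorm (x - y)).
Context (f_var : forall x,
  n%:R^-1 * \sum_(i < n) enorm (grad (f i) x - grad (favg f) x) ^+ 2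
    <= sigma ^+ 2).

Lemma grad_favgE x : grad (favg f) x = n%:R^-1 *: \sum_(i < n) grad (f i) x.
Proof. by apply: grad_favg => i; exact: f_diff. Qed.

(** The descent inequality is affine in the function, so it passes from the f_i
    to their mean with the same constant. *)
Lemma favg_descent x y :
  favg f y <= favg f x + dotv (grad (favg f) x) (y - x)
              + L / 2 * enorm (y - x) ^+ 2.
Proof.
have nn0 : n%:R != 0 :> R by rewrite pnatr_eq0 -lt0n.
rewrite grad_favgE dotvZl dotv_suml.
have -> : L / 2 * enorm (y - x) ^+ 2
    = n%:R^-1 * \sum_(i < n) (L / 2 * enorm (y - x) ^+ 2).
  by rewrite sumr_const card_ord -(mulr_natl (_ * _) n) mulKf.
rewrite -!mulrDr -!big_split ler_wpM2l ?invr_ge0 // ler_sum //= => i _.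
exact: descent_lemma.
Qed.

(** The linear term -eta <grad F(x), v> is written by polarization with the
    square error of [v] as an estimate of the gradient. *)
Lemma descent_step (eta : R) x v :
  favg f (x - eta *: v) <= favg f x - eta / 2 * enorm (grad (favg f) x) ^+ 2
    - eta / 2 * (1 - L * eta) * enorm v ^+ 2
    + eta / 2 * enorm (v - grad (favg f) x) ^+ 2.
Proof.
apply: (le_trans (favg_descent x _)).
have -> : x - eta *: v - x = - eta *: v by rewrite addrAC subrr add0r scaleNr.
rewrite enormZ_sq dotvZr enormB_sq dotvC.
by rewrite sqrrN le_eqVlt; apply/orP; left; apply/eqP; field.
Qed.

(** The mini-batch part of a direction averages grad f_i(x) - grad f_i(xt) over
    the batch.  Its mean is grad F(x) - grad F(xt), and what is left of the
    direction is the anchor error. *)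
Lemma avg_dir_error (B : nat) (xt x : 'rV[R]_d) (A : {set 'I_n}) :
  (0 < B)%N ->
  #|{: B.-tuple 'I_n}|%:R^-1 * \sum_(b : B.-tuple 'I_n)
     enorm (svrg_dir f xt A b x - grad (favg f) x) ^+ 2
  <= enorm (batch_grad f (enum A) xt - grad (favg f) xt) ^+ 2
     + B%:R^-1 * (L ^+ 2 * enorm (x - xt) ^+ 2).
Proof.
move=> B0; pose v i := grad (f i) x - grad (f i) xt.
have nn0 : n%:R != 0 :> R by rewrite pnatr_eq0 -lt0n.
pose mu := n%:R^-1 *: \sum_i v i.
have muE : mu = grad (favg f) x - grad (favg f) xt.
  by rewrite /mu sumrB scalerBr -!grad_favgE.
under eq_bigr => b _.
  have -> : svrg_dir f xt A b x - grad (favg f) x =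
    B%:R^-1 *: \sum_(i <- b) v i - mu + (batch_grad f (enum A) xt - grad (favg f) xt).
    rewrite /svrg_dir muE sumrB scalerBr {1 2}/batch_grad size_tuple.
    by apply/rowP => j; rewrite !mxE; ring.
  over.
have := @avg_tuple_enorm_sq R 'I_n d B v
  (batch_grad f (enum A) xt - grad (favg f) xt).
rewrite card_ord => /(_ n_gt0 B0) /le_trans; apply.
rewrite lerD2l ler_wpM2l ?invr_ge0 //.
rewrite ler_pdivrMl ?ltr0n //.
have -> : n%:R * (L ^+ 2 * enorm (x - xt) ^+ 2)
    = \sum_(i < n) (L ^+ 2 * enorm (x - xt) ^+ 2).
  by rewrite sumr_const card_ord mulr_natl.
apply: ler_sum => i _; have l := f_lip i x xt.
by rewrite -exprMn lerXn2r ?nnegrE ?enorm_ge0 // (le_trans _ l) ?enorm_ge0.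
Qed.

Context (cb ce eps alpha : R).
Context (sigma_gt0 : 0 < sigma) (eps_gt0 : 0 < eps) (alpha_gt0 : 0 < alpha).
Context (cb_ge : alpha <= cb) (ce_ge : alpha <= ce).

(** When the sample is not exhaustive, the minimum that defines its size is
    cb sigma^2 / beta or ce sigma^2 / eps, and N is at least this minimum; the
    two cases give beta / alpha and eps / alpha. *)
Lemma anchor_sizeP (beta : R) : 0 <= beta ->
  let N := anchor_size n cb ce sigma eps beta in
  (0 < N <= n)%N /\ ((N < n)%N -> N%:R^-1 * sigma ^+ 2 <= (beta + eps) / alpha).
Proof.
move=> beta0 N.
have cb0 : 0 < cb by exact: lt_le_trans cb_ge.
have ce0 : 0 < ce by exact: lt_le_trans ce_ge.
have s2 : 0 < sigma ^+ 2 by rewrite exprn_gt0.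
pose c := Num.min (ce * sigma ^+ 2 * eps^-1) n%:R.
pose r := if beta == 0 then c else Num.min (cb * sigma ^+ 2 * beta^-1) c.
have c0 : 0 < c by rewrite lt_min ltr0n n_gt0 !mulr_gt0 ?invr_gt0.
have r0 : 0 < r.
  rewrite /r; case: eqVneq => // bn0.
  by rewrite lt_min c0 !mulr_gt0 ?invr_gt0 // lt_neqAle eq_sym bn0.
have NE : N%:R = (Num.ceil r)%:~R :> R.
  rewrite /N /anchor_size -/c -/r natr_absz ger0_norm // ceil_ge0.
  by rewrite (lt_trans _ r0) // ltrN10.
have rN : r <= N%:R by rewrite NE ceil_ge.
have N0 : (0 < N)%N by rewrite -(ltr0n R) (lt_le_trans r0).
have NgtR : 0 < N%:R :> R by rewrite ltr0n.
have cn : c <= n%:R by rewrite ge_min lexx orbT.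
have rn : r <= n%:R by rewrite /r; case: eqP => // _; rewrite ge_min cn orbT.
have Nn : (N <= n)%N.
  rewrite -(ler_nat R) NE -[n%:R]/(n%:Z%:~R) ler_int.
  by rewrite ceil_le_int.
split; first by rewrite N0.
move=> ltNn; have rltn : r < n%:R by rewrite (le_lt_trans rN) // ltr_nat.
rewrite ler_pdivrMl // mulrA ler_pdivlMr //.
have key : ce * sigma ^+ 2 * eps^-1 <= N%:R \/
   (beta != 0 /\ cb * sigma ^+ 2 * beta^-1 <= N%:R).
  move: rN rltn; rewrite /r /c; case: eqVneq => [_|bn0].
    by rewrite ge_min gt_min ltxx orbF => /orP[->|]; [left|rewrite ler_nat leqNgt ltNn].
  rewrite !ge_min => /or3P[h|h|]; [by right|by left|].
  by rewrite ler_nat leqNgt ltNn.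
case: key => [|[bn0]].
  rewrite ler_pdivrMr // => h.
  apply: (@le_trans _ _ (ce * sigma ^+ 2)); first by rewrite mulrC ler_wpM2r // ltW.
  by apply: (le_trans h); rewrite ler_wpM2l // lerDr.
rewrite ler_pdivrMr ?lt_neqAle 1?eq_sym ?bn0 // => h.
apply: (@le_trans _ _ (cb * sigma ^+ 2)); first by rewrite mulrC ler_wpM2r // ltW.
by apply: (le_trans h); rewrite ler_wpM2l // lerDl ltW.
Qed.

Lemma avg_anchor_error (beta : R) xt :
  let C := [set A : {set 'I_n} | #|A| == anchor_size n cb ce sigma eps beta]%SET in
  0 <= beta ->
  #|C|%:R^-1 * \sum_(A in C) enorm (batch_grad f (enum A) xt - grad (favg f) xt) ^+ 2
  <= (beta + eps) / alpha.
Proof.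
move=> C beta0; have [NI Nlt] := anchor_sizeP beta0.
set N := anchor_size _ _ _ _ _ _ in C NI Nlt *.
have := @avg_subset_enorm_sq R 'I_n d N (fun i => grad (f i) xt).
rewrite card_ord -grad_favgE => /(_ NI) h.
have -> : \sum_(A in C) enorm (batch_grad f (enum A) xt - grad (favg f) xt) ^+ 2
  = \sum_(A in C) enorm (N%:R^-1 *: \sum_(i in A) grad (f i) xt - grad (favg f) xt) ^+ 2.
  apply: eq_bigr => A; rewrite inE => /eqP AN.
  by rewrite /batch_grad -cardE AN big_enum.
apply: (le_trans h).
have [/Nlt lt|_] := boolP (N < n)%N; last first.
  by rewrite mul0r divr_ge0 ?addr_ge0 // ltW.
by rewrite mul1r (le_trans _ lt) // ler_wpM2l ?invr_ge0 ?f_var.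
Qed.

End Directions.

(** * Descent along one trajectory *)

Lemma ler_sum_widen (R : numDomainType) (k m : nat) (F : nat -> R) :
  (k <= m)%N -> (forall r, 0 <= F r) -> \sum_(r < k) F r <= \sum_(r < m) F r.
Proof.
move=> km F0; rewrite (big_ord_widen _ _ km) [leLHS]big_mkcond.
by apply: ler_sum => r _; case: ifP.
Qed.

Section Descent.
Context {R : realType} {d n m B : nat}.
Context (f : 'I_n -> 'rV[R]_d -> R) (x0 : 'rV[R]_d) (eta beta1 : R).
Implicit Types w : draws n B.

Notation ep := (epoch m f x0 eta beta1).
Notation it := (iterate m f x0 eta beta1).

(** In the usual numbering of the epochs this is v_t^{s+1}. *)
Definition dir w s t : 'rV[R]_d :=
  svrg_dir f (ep w s).1 (anchor w s) (batch w s t) (it w s t).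

Lemma iterate0 w s : it w s 0 = (ep w s).1.
Proof. by []. Qed.

Lemma iterateS w s t : it w s t.+1 = it w s t - eta *: dir w s t.
Proof. by []. Qed.

Lemma epochS1 w s : (ep w s.+1).1 = it w s m.
Proof. by []. Qed.

Lemma epochS2 w s :
  (ep w s.+1).2 = m%:R^-1 * \sum_(t < m) enorm (dir w s t) ^+ 2.
Proof. by []. Qed.

Lemma epoch_beta_ge0 w s : 0 <= beta1 -> 0 <= (ep w s).2.
Proof.
case: s => // s _; rewrite epochS2 mulr_ge0 ?invr_ge0 // sumr_ge0 // => t _.
exact: sqr_ge0.
Qed.

Lemma iterate_drift w s t :
  it w s t - (ep w s).1 = - eta *: \sum_(r < t) dir w s r.
Proof.
elim: t => [|t IH]; first by rewrite big_ord0 scaler0 iterate0 subrr.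
by rewrite iterateS big_ord_recr /= [RHS]scalerDr [LHS]addrAC IH [X in _ = _ + X]scaleNr.
Qed.

(** Each drift is -eta times a sum of at most m directions, and there are m of
    them: hence the factor m^2. *)
Lemma sum_drift w s :
  \sum_(t < m) enorm (it w s t - (ep w s).1) ^+ 2
  <= eta ^+ 2 * m%:R ^+ 2 * \sum_(t < m) enorm (dir w s t) ^+ 2.
Proof.
set V := \sum_(t < m) enorm (dir w s t) ^+ 2.
have bound (t : 'I_m) :
    enorm (it w s t - (ep w s).1) ^+ 2 <= eta ^+ 2 * m%:R * V.
  rewrite iterate_drift enormZ_sq sqrrN -mulrA ler_wpM2l ?sqr_ge0 //.
  have V0 : 0 <= \sum_(r < t) enorm (dir w s r) ^+ 2.
    by rewrite sumr_ge0 // => r _; exact: sqr_ge0.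
  apply: (le_trans (enorm_sum_sq_le _)); apply: ler_pM => //.
    by rewrite ler_nat ltnW.
  apply: (ler_sum_widen (F := fun r => enorm (dir w s r) ^+ 2)) (ltnW _) _ => // r.
  exact: sqr_ge0.
apply: (le_trans (ler_sum _ (fun t _ => bound t))).
by rewrite sumr_const card_ord -[leLHS]mulr_natl [leLHS]mulrCA; nra.
Qed.

(** Apart from [beta1], the betas are the mean square directions of the previous
    epochs; the one of the last epoch is left out. *)
Lemma sum_beta w S (V := \sum_(s < S) \sum_(t < m) enorm (dir w s t) ^+ 2) :
  (0 < m)%N -> 0 <= beta1 ->
  m%:R * \sum_(s < S) (ep w s).2 <= m%:R * beta1 + V.
Proof.
move=> m0 b0; have mn0 : m%:R != 0 :> R by rewrite pnatr_eq0 -lt0n.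
rewrite {}/V; case: S => [|S]; first by rewrite !big_ord0 mulr0 addr0 mulr_ge0.
rewrite big_ord_recl mulrDr lerD2l mulr_sumr big_ord_recr /=.
have -> : \sum_(s < S) m%:R * (ep w (bump 0 s)).2
  = \sum_(s < S) \sum_(t < m) enorm (dir w s t) ^+ 2.
  by apply: eq_bigr => s _; rewrite epochS2 mulVKf.
by rewrite lerDl sumr_ge0 // => t _; exact: sqr_ge0.
Qed.

Lemma run_descent w S (L : R) :
  (forall x v, favg f (x - eta *: v) <= favg f x
    - eta / 2 * enorm (grad (favg f) x) ^+ 2
    - eta / 2 * (1 - L * eta) * enorm v ^+ 2
    + eta / 2 * enorm (v - grad (favg f) x) ^+ 2) ->
  favg f (ep w S).1 <= favg f x0
    - eta / 2 * (\sum_(s < S) \sum_(t < m) enorm (grad (favg f) (it w s t)) ^+ 2)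
    - eta / 2 * (1 - L * eta) * (\sum_(s < S) \sum_(t < m) enorm (dir w s t) ^+ 2)
    + eta / 2 * (\sum_(s < S) \sum_(t < m)
         enorm (dir w s t - grad (favg f) (it w s t)) ^+ 2).
Proof.
move=> step.
have inner_descent s t : favg f (it w s t) <= favg f (ep w s).1
    - eta / 2 * (\sum_(r < t) enorm (grad (favg f) (it w s r)) ^+ 2)
    - eta / 2 * (1 - L * eta) * (\sum_(r < t) enorm (dir w s r) ^+ 2)
    + eta / 2 * (\sum_(r < t)
         enorm (dir w s r - grad (favg f) (it w s r)) ^+ 2).
  elim: t => [|t IH].
    by rewrite !big_ord0 !mulr0 !subr0 addr0 iterate0.
  rewrite iterateS !big_ord_recr /=.
  have := step (it w s t) (dir w s t); lra.
elim: S => [|S IH].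
  by rewrite !big_ord0 !mulr0 !subr0 addr0.
rewrite epochS1 !big_ord_recr /=.
have := inner_descent S m; lra.
Qed.

End Descent.

(** * Convergence in expectation *)

Section Convergence.
Context {R : realType} {d n m B S : nat} (f : 'I_n -> 'rV[R]_d -> R).
Context (L sigma : R) (x0 : 'rV[R]_d) (eta cb ce beta1 eps alpha : R).
Context (n_gt0 : (0 < n)%N) (m_gt0 : (0 < m)%N) (B_gt0 : (0 < B)%N).
Context (f_diff : forall i (x : 'rV[R]_d), differentiable (f i) x).
Context (f_lip : forall i x y,
  enorm (grad (f i) x - grad (f i) y) <= L * enorm (x - y)).
Context (f_var : forall x,
  n%:R^-1 * \sum_(i < n) enorm (grad (f i) x - grad (favg f) x) ^+ 2
    <= sigma ^+ 2).
Context (sigma_gt0 : 0 < sigma) (beta1_gt0 : 0 < beta1) (eps_gt0 : 0 < eps).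
Context (alpha_gt0 : 0 < alpha) (cb_ge : alpha <= cb) (ce_ge : alpha <= ce).
Context (beta1_le : beta1 <= eps * S%:R).
Context {d' : measure_display} {T : measurableType d'} {P : probability T R}.
Context {D : T -> draws n B} {zeta : T -> 'I_S * 'I_m}.
Context (run : is_run f x0 eta cb ce beta1 sigma eps P D zeta).

Notation ep := (epoch m f x0 eta beta1).
Notation it := (iterate m f x0 eta beta1).
Notation dr := (dir (m := m) f x0 eta beta1).
Notation gF := (grad (favg f)).
Notation E := (Ex (m := m) (S := S) n_gt0 P D).
Notation anchor_err w s :=
  (batch_grad f (enum (anchor w s)) (ep w s).1 - gF (ep w s).1).

Lemma Ex_anchor_error s : (s < S)%N ->
  E (fun w => enorm (anchor_err w s) ^+ 2)
  <= E (fun w => ((ep w s).2 + eps) / alpha).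
Proof.
move=> sS.
pose F (w : draws n B) (A : {set 'I_n}) :=
  enorm (batch_grad f (enum A) (ep w s).1 - gF (ep w s).1) ^+ 2.
have HF w w' : agree_epochs m s w w' -> F w =1 F w'.
  by move=> h A; rewrite /F (epoch_ext _ _ _ _ h).
have -> := Ex_anchor n_gt0 run sS HF.
apply: Ex_le => w; apply: avg_anchor_error; try assumption.
exact/epoch_beta_ge0/ltW.
Qed.

Lemma Ex_dir_error s t : (s < S)%N -> (t < m)%N ->
  E (fun w => enorm (dr w s t - gF (it w s t)) ^+ 2)
  <= E (fun w => ((ep w s).2 + eps) / alpha
                 + B%:R^-1 * (L ^+ 2 * enorm (it w s t - (ep w s).1) ^+ 2)).
Proof.
move=> sS tm.
pose F (w : draws n B) (b : B.-tuple 'I_n) :=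
  enorm (svrg_dir f (ep w s).1 (anchor w s) b (it w s t) - gF (it w s t)) ^+ 2.
have HF w w' : agree_steps m s t w w' -> F w =1 F w'.
  move=> h b; case: (h) => h1 h2 _.
  by rewrite /F (iterate_ext _ _ _ _ h) (epoch_ext _ _ _ _ h1) h2.
have -> := Ex_batch n_gt0 run sS tm HF.
apply: (@le_trans _ _ (E (fun w => enorm (anchor_err w s) ^+ 2
    + B%:R^-1 * (L ^+ 2 * enorm (it w s t - (ep w s).1) ^+ 2)))).
  by apply: Ex_le => w; apply: avg_dir_error.
by rewrite !ExD lerD2r; exact: Ex_anchor_error.
Qed.

(** The betas and the drifts are both controlled by the square directions, so
    the right-hand sides of [Ex_dir_error] add up to a multiple of their sum.
    This holds for each realization; [beta1] contributes at most K eps / alpha,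
    and the terms eps / alpha together contribute the same. *)
Lemma sum_error_bound (w : draws n B) :
  \sum_(s < S) \sum_(t < m) (((ep w s).2 + eps) / alpha
     + B%:R^-1 * (L ^+ 2 * enorm (it w s t - (ep w s).1) ^+ 2))
  <= (eta ^+ 2 * L ^+ 2 * m%:R ^+ 2 / B%:R + 1 / alpha)
       * (\sum_(s < S) \sum_(t < m) enorm (dr w s t) ^+ 2)
     + 2 * (S%:R * m%:R) * eps / alpha.
Proof.
set V := (X in _ <= _ * X + _).
pose c := B%:R^-1 * L ^+ 2 * (eta ^+ 2 * m%:R ^+ 2).
have c0 : 0 <= B%:R^-1 * L ^+ 2 by rewrite mulr_ge0 ?invr_ge0 ?sqr_ge0.
have epoch_bound (s : 'I_S) :
    \sum_(t < m) (((ep w s).2 + eps) / alpha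
       + B%:R^-1 * (L ^+ 2 * enorm (it w s t - (ep w s).1) ^+ 2))
    <= m%:R * (((ep w s).2 + eps) / alpha)
       + c * \sum_(t < m) enorm (dr w s t) ^+ 2.
  rewrite big_split /= sumr_const card_ord -(mulr_natl (_ / _) m) lerD2l.
  under eq_bigr do rewrite mulrA.
  by rewrite -mulr_sumr /c -mulrA ler_wpM2l // sum_drift.
apply: (le_trans (ler_sum _ (fun s _ => epoch_bound s))).
rewrite big_split /= -!mulr_sumr -/V.
rewrite -mulr_suml big_split /= sumr_const card_ord.
rewrite -(mulr_natl eps S).
have := sum_beta f x0 eta w S m_gt0 (ltW beta1_gt0); rewrite -/V.
have mR : 0 < m%:R :> R by rewrite ltr0n.
have : m%:R * beta1 <= m%:R * (eps * S%:R) by rewrite ler_pM2l.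
have -> : eta ^+ 2 * L ^+ 2 * m%:R ^+ 2 / B%:R = c by rewrite /c; ring.
move: (\sum_(s < S) _) => Sb h1 h2.
have -> : (c + 1 / alpha) * V + 2 * (S%:R * m%:R) * eps / alpha
  = (m%:R * (eps * S%:R) + V + m%:R * (S%:R * eps)) / alpha + c * V by ring.
rewrite lerD2r mulrA ler_pM2r ?invr_gt0 // mulrDr; lra.
Qed.

Lemma Ex_sum_dir_error :
  E (fun w => \sum_(s < S) \sum_(t < m) enorm (dr w s t - gF (it w s t)) ^+ 2)
  <= (eta ^+ 2 * L ^+ 2 * m%:R ^+ 2 / B%:R + 1 / alpha)
       * E (fun w => \sum_(s < S) \sum_(t < m) enorm (dr w s t) ^+ 2)
     + 2 * (S%:R * m%:R) * eps / alpha.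
Proof.
rewrite -ExZ -[X in _ + X](Ex_cst n_gt0 run) -ExD.
apply: le_trans (Ex_le n_gt0 P D sum_error_bound).
rewrite !Ex_sum; apply: ler_sum => s _; rewrite !Ex_sum.
by apply: ler_sum => t _; exact: Ex_dir_error.
Qed.

Lemma Ex_descent : has_lbound (range (favg f)) ->
  inf (range (favg f)) <= favg f x0
    - eta / 2 * E (fun w => \sum_(s < S) \sum_(t < m) enorm (gF (it w s t)) ^+ 2)
    - eta / 2 * (1 - L * eta)
      * E (fun w => \sum_(s < S) \sum_(t < m) enorm (dr w s t) ^+ 2)
    + eta / 2 * E (fun w => \sum_(s < S) \sum_(t < m)
                      enorm (dr w s t - gF (it w s t)) ^+ 2).
Proof.
move=> lb.
rewrite -(Ex_cst n_gt0 run (inf (range (favg f)))) -[favg f x0](Ex_cst n_gt0 run).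
rewrite -!mulNr -!ExZ -!ExD; apply: Ex_le => w.
have := @run_descent R d n m B f x0 eta beta1 w S L
  (descent_step n_gt0 f_diff f_lip eta).
have lbw : inf (range (favg f)) <= favg f (ep w S).1.
  by apply: (ge_inf lb); exists (ep w S).1.
by move=> /(le_trans lbw) h; rewrite !mulNr.
Qed.

(** |g|^2 <= 2 |v - g|^2 + 2 |v|^2 at each step. *)
Lemma Ex_sum_grad_le :
  E (fun w => \sum_(s < S) \sum_(t < m) enorm (gF (it w s t)) ^+ 2)
  <= 2 * E (fun w => \sum_(s < S) \sum_(t < m)
                      enorm (dr w s t - gF (it w s t)) ^+ 2)
     + 2 * E (fun w => \sum_(s < S) \sum_(t < m) enorm (dr w s t) ^+ 2).
Proof.
rewrite -!ExZ -!ExD; apply: Ex_le => w.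
rewrite !mulr_sumr -big_split /=; apply: ler_sum => s _.
rewrite !mulr_sumr -big_split /=; apply: ler_sum => t _.
have := sqr_ge0 (enorm (gF (it w s t) - 2 *: dr w s t)).
move: (gF _) (dr w s t) => a b.
rewrite !enormB_sq enormZ_sq dotvZr (dotvC a b); lra.
Qed.

End Convergence.

Theorem theorem1 (R : realType) (d n : nat) (f : 'I_n -> 'rV[R]_d -> R)
    (L sigma : R)
    (n_gt0 : (0 < n)%N)
    (f_diff : forall i (x : 'rV[R]_d), differentiable (f i) x)
    (f_lip : forall i x y,
      enorm (grad (f i) x - grad (f i) y) <= L * enorm (x - y))
    (f_lb : has_lbound (range (favg f)))
    (sigma_gt0 : 0 < sigma)
    (f_var : forall x,
      n%:R^-1 * \sum_(i < n) enorm (grad (f i) x - grad (favg f) x) ^+ 2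
        <= sigma ^+ 2)
    (x0 : 'rV[R]_d) (m B S : nat) (eta cb ce beta1 eps alpha : R)
    (m_gt0 : (0 < m)%N) (B_gt0 : (0 < B)%N) (S_gt0 : (0 < S)%N)
    (eta_gt0 : 0 < eta) (beta1_gt0 : 0 < beta1) (eps_gt0 : 0 < eps)
    (alpha_gt0 : 0 < alpha) (cb_ge : alpha <= cb) (ce_ge : alpha <= ce)
    (beta1_le : beta1 <= eps * S%:R)
    (d' : measure_display) (T : measurableType d') (P : probability T R)
    (D : T -> draws n B) (zeta : T -> 'I_S * 'I_m)
    (run : is_run f x0 eta cb ce beta1 sigma eps P D zeta) :
  let psi := 2 * eta ^+ 2 * L ^+ 2 * m%:R ^+ 2 / B%:R + 2 / alpha + 2 in
  let phi := 1 / 2 - 1 / (2 * alpha) - L * eta / 2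
             - eta ^+ 2 * L ^+ 2 * m%:R ^+ 2 / (2 * B%:R) in
  let K := (S * m)%N in
  let fstar := inf (range (favg f)) in
  0 < phi ->
  let x_zeta om := iterate m f x0 eta beta1 (D om) (zeta om).1 (zeta om).2 in
  ('E_P[fun om => (enorm (grad (favg f) (x_zeta om)) ^+ 2)%R]
   <= (psi * (favg f x0 - fstar) / (phi * eta * K%:R)
       + psi * eps / (phi * alpha) + 4 * eps / alpha)%R%:E)%E.
Proof.
move=> psi phi K fstar phi_gt0; cbv zeta.
pose g (w : draws n B) s t := grad (favg f) (iterate m f x0 eta beta1 w s t).
rewrite (expectation_output n_gt0 run (F := fun w s t => enorm (g w s t) ^+ 2));
  first last.
- by move=> w s t; exact: sqr_ge0.
- move=> w w' h s t; congr (enorm _ ^+ 2); rewrite /g.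
  congr (grad _ _); apply: iterate_ext.
  by apply: agree_epochsW (ltnW (ltn_ord t)) _; exact: agree_epochs_le h.
rewrite lee_fin ExZ.
have Q_le := Ex_sum_dir_error n_gt0 m_gt0 B_gt0 f_diff f_lip f_var sigma_gt0
  beta1_gt0 eps_gt0 alpha_gt0 cb_ge ce_ge beta1_le run.
have descent := Ex_descent n_gt0 f_diff f_lip run f_lb.
have G_le := Ex_sum_grad_le (m := m) (S := S) (P := P) (D := D) f x0 eta beta1
  n_gt0.
have G_ge0 : 0 <= Ex (m := m) (S := S) n_gt0 P D
    (fun w => \sum_(s < S) \sum_(t < m) enorm (g w s t) ^+ 2).
  apply: Ex_ge0 => w; apply: sumr_ge0 => s _; apply: sumr_ge0 => t _.
  exact: sqr_ge0.
move: Q_le descent G_le G_ge0; rewrite /g -/fstar -natrM -/K.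
set Q := Ex n_gt0 P D _; set V := Ex n_gt0 P D _; set G := Ex n_gt0 P D _.
move=> Q_le descent G_le G_ge0.
have k_gt0 : 0 < K%:R :> R by rewrite ltr0n muln_gt0 S_gt0.
move: K%:R k_gt0 Q_le => k k_gt0 Q_le.
pose c := eta ^+ 2 * L ^+ 2 * m%:R ^+ 2 / B%:R.
have c_ge0 : 0 <= c by rewrite divr_ge0 // -!exprMn sqr_ge0.
have a_gt0 : 0 < alpha^-1 by rewrite invr_gt0.
have psiE : psi = 2 * c + 2 * alpha^-1 + 2 by rewrite /psi /c; ring.
have phiE : 2 * phi = 1 - alpha^-1 - L * eta - c.
  by rewrite /phi /c; field; rewrite !gt_eqF ?ltr0n.
(* The descent inequality with the bound on Q, where G >= 0 is dropped. *)
have V_le : V <= (favg f x0 - fstar + eta * k * eps / alpha) / (phi * eta).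
  rewrite ler_pdivlMr ?mulr_gt0 //.
  have h1 : 0 <= eta * ((c + 1 / alpha) * V + 2 * k * eps / alpha - Q).
    by rewrite mulr_ge0 ?subr_ge0 // ltW.
  have h2 : 0 <= eta * G by rewrite mulr_ge0 // ltW.
  have -> : V * (phi * eta) = V * eta * (2 * phi) / 2 by field.
  by rewrite phiE; lra.
have G_le_V : G <= psi * V + k * (4 * eps / alpha).
  by rewrite psiE; move: Q_le; rewrite -/c; lra.
rewrite ler_pdivrMl //; apply: (le_trans G_le_V).
have -> : k * (psi * (favg f x0 - fstar) / (phi * eta * k)
              + psi * eps / (phi * alpha) + 4 * eps / alpha)
  = psi * ((favg f x0 - fstar + eta * k * eps / alpha) / (phi * eta))
    + k * (4 * eps / alpha).
  by field; rewrite !gt_eqF.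
by rewrite lerD2r ler_wpM2l // psiE; lra.
Qed.
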